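(* Let $n>h\geq 0$ be integers, and let $M_n^{(h)}$ be the number of edges of the Hasse diagram of the poset of independent sets of $\mathbf{C}_n^{(h)}$ ordered by inclusion. Then \[ M_n^{(h)}=\sum_{i=1}^{n-h} F_i^{(h)}L_{n-h-i+1}^{(h)}. \]
   Context: For $n,h\geq 0$, the $h$-power of a cycle $\mathbf{C}_n^{(h)}$ is the graph with vertices $v_1,\dots,v_n$ in which, for $i\neq j$, $v_i$ and $v_j$ are adjacent if and only if $|j-i|\leq h$ or $|j-i|\geq n-h$. An independent set of a graph is a subset of its vertex set containing no two adjacent vertices. The $h$-Fibonacci sequence $(F_n^{(h)})_{n\geq 1}$ is defined by $F_n^{(h)}=1$ for $1\leq n\leq h+1$ and $F_n^{(h)}=F_{n-1}^{(h)}+F_{n-h-1}^{(h)}$ for $n>h+1$. The $h$-Lucas sequence $(L_n^{(h)})_{n\geq 1}$ is defined by $L_1^{(h)}=h+1$, $L_n^{(h)}=1$ for $2\leq n\leq h+1$, and $L_n^{(h)}=L_{n-1}^{(h)}+L_{n-h-1}^{(h)}$ for $n>h+1$. *)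

(* Defs.v *)
From HB Require Import structures.
From mathcomp Require Import all_boot all_order all_algebra.

Set Implicit Arguments.
Unset Strict Implicit.
Unset Printing Implicit Defensive.

(* Orders {set T} by inclusion; indep_set below inherits this order. *)
Import Order.DefaultSetSubsetOrder.

(* The vertex v_k is the ordinal k.-1 : 'I_n; the shift does not affect the
   differences |j - i|. *)
Definition cycle_power (n h : nat) : rel 'I_n :=
  fun i j => (i != j) && ((`|j - i| <= h) || (`|j - i| >= n - h)).

Definition independent (T : finType) (e : rel T) : pred {set T} :=
  fun A => [forall x in A, forall y in A, ~~ e x y].

Record indep_set (T : finType) (e : rel T) :=
  IndepSet { indep_val :> {set T}; _ : independent e indep_val }.

HB.instance Definition _ (T : finType) (e : rel T) :=
  [isSub for @indep_val T e].
HB.instance Definition _ (T : finType) (e : rel T) :=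
  [Finite of indep_set e by <:].
HB.instance Definition _ (T : finType) (e : rel T) :=
  [SubChoice_isSubPOrder of indep_set e by <:
     with Order.SetSubsetOrder.subset_display].

Lemma le_indepE (T : finType) (e : rel T) (A B : indep_set e) :
  (A <= B)%O = ((A : {set T}) \subset (B : {set T})).
Proof. by rewrite -Order.le_val. Qed.

Lemma lt_indepE (T : finType) (e : rel T) (A B : indep_set e) :
  (A < B)%O = ((A : {set T}) \proper (B : {set T})).
Proof.
by rewrite Order.POrderTheory.lt_neqAle le_indepE properEneq (inj_eq val_inj).
Qed.

Definition covered_by (d : Order.disp_t) (P : finPOrderType d) : rel P :=
  fun x y => (x < y)%O && ~~ [exists z : P, (x < z < y)%O].

(* An edge of the Hasse diagram is recorded as the pair (lower, upper). *)
Definition hasse_edges (d : Order.disp_t) (P : finPOrderType d) : {set P * P} :=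
  [set p | covered_by p.1 p.2].

(* The sequences start at index 1; the value at index 0 is a dummy. For
   n = m.+1, the indices n - 1 and n - h - 1 are m and m - h. *)
Fixpoint hfib (h n : nat) : nat :=
  if n is m.+1 then
    if m <= h then 1 else hfib h m + hfib h (m - h)
  else 0.

Fixpoint hlucas (h n : nat) : nat :=
  if n is m.+1 then
    if m == 0 then h.+1
    else if m <= h then 1 else hlucas h m + hlucas h (m - h)
  else 0.

Lemma hfib_init h n : 1 <= n <= h + 1 -> hfib h n = 1.
Proof. by case: n => // m; rewrite addn1 /= ltnS => ->. Qed.

Lemma hfib_rec h n : n > h + 1 -> hfib h n = hfib h (n - 1) + hfib h (n - h - 1).
Proof.
case: n => // m; rewrite addn1 ltnS => hm /=.
by rewrite leqNgt hm subSS subn0 -subnDA addn1 subSS.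
Qed.

Lemma hlucas1 h : hlucas h 1 = h + 1.
Proof. by rewrite addn1. Qed.

Lemma hlucas_init h n : 2 <= n <= h + 1 -> hlucas h n = 1.
Proof. by case: n => [|[|m]] //; rewrite addn1 /= ltnS => ->. Qed.

Lemma hlucas_rec h n :
  n > h + 1 -> hlucas h n = hlucas h (n - 1) + hlucas h (n - h - 1).
Proof.
case: n => // m; rewrite addn1 ltnS => hm /=.
rewrite leqNgt hm subSS subn0 -subnDA addn1 subSS.
by case: m hm.
Qed.

(* Main.v *)
Require Import Defs.
From HB Require Import structures.
From mathcomp Require Import all_boot all_order all_algebra.
From mathcomp Require Import zify.

(** An edge of the Hasse diagram is a pair (B minus x, B) with x in B, so M is
    the number of pairs (x, B) with x in the independent set B. By rotation
    this is n times the number of independent sets containing the last vertex,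
    i.e. of independent sets avoiding its closed neighbourhood; splitting on
    the largest vertex, these are counted by the h-Fibonacci number
    F_(n-h). Finally the convolution sum_(1 <= i <= m) F_i L_(m-i+1) and
    (m + h) F_m both satisfy X_m = X_(m-1) + X_(m-h-1) + L_m. *)

Section IndependentSets.

Variables (T : finType) (e : rel T).

Lemma independentP (A : {set T}) :
  reflect {in A &, forall x y, ~~ e x y} (independent e A).
Proof.
apply: (iffP forall_inP) => [eA x y Ax Ay | eA x Ax].
  by move/forall_inP: (eA x Ax) => /(_ y Ay).
by apply/forall_inP => y Ay; exact: eA.
Qed.

Lemma independentS (A B : {set T}) :
  A \subset B -> independent e B -> independent e A.
Proof.
move=> /subsetP sAB /independentP eB; apply/independentP => x y Ax Ay.
by apply: eB; exact: sAB.
Qed.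

(** Independence passes to subsets, so for [x] in [B] outside [A] the set [B :\ x] is independent
    and lies between [A] and [B]. *)
Lemma covered_by_indepE (A B : indep_set e) :
  covered_by A B = ((A : {set T}) \in [set (B : {set T}) :\ x | x in (B : {set T})]).
Proof.
apply/andP/imsetP => [[ltAB noC] | [x Bx defA]].
  move: ltAB; rewrite lt_indepE => /properP[sAB [x Bx nAx]].
  exists x => //.
  have sAC : A \subset (B : {set T}) :\ x by rewrite subsetD1 sAB.
  have eC := independentS _ _ (subsetDl B [set x]) (valP B).
  pose C := IndepSet eC.
  apply/eqP; rewrite eqEsubset sAC /=; apply: contraR noC => nCA.
  by apply/existsP; exists C; rewrite !lt_indepE /= properE sAC nCA properD1.
rewrite lt_indepE defA properD1 //; split=> //.
apply/existsP => -[C]; rewrite !lt_indepE defA.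
move=> /andP[/proper_card lt1 /proper_card lt2].
by move: lt1 lt2; rewrite (cardsD1 x B) Bx add1n ltnS => /leq_trans/[apply]; rewrite ltnn.
Qed.

(** Each [B] covers [#|B|] sets, one per removed vertex; exchanging the sums counts the pairs
    [(x, B)] by vertex. *)
Lemma card_hasse_edges_indep :
  #|hasse_edges (indep_set e)|
  = \sum_(x : T) #|[set A : {set T} | independent e A & x \in A]|.
Proof.
have card_below (B : indep_set e) : #|[set A | covered_by A B]| = #|(B : {set T})|.
  rewrite -(card_imset _ val_inj) -[RHS](@card_in_imset _ _ (fun x => (B : {set T}) :\ x)).
    apply: eq_card => A; apply/imsetP/idP => [[C] | AB].
      by rewrite inE covered_by_indepE => ? ->.
    have eA : independent e A.
      by case/imsetP: AB => x _ ->; apply: independentS (subsetDl _ _) (valP B).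
    by exists (IndepSet eA); rewrite // inE covered_by_indepE.
  by move=> x y Bx By /setP/(_ x); rewrite !inE eqxx Bx andbT /=; case: eqP.
transitivity (\sum_(B : indep_set e) #|(B : {set T})|).
  rewrite -sum1_card (eq_bigl (fun p => covered_by p.1 p.2)); last by move=> p; rewrite inE.
  rewrite (partition_big snd xpredT) //=; apply: eq_bigr => B _.
  rewrite -(card_below B) -sum1_card.
  rewrite (reindex_onto (fun A => (A, B)) fst) /=; last by case=> ? ? /= /andP[_ /eqP ->].
  by apply: eq_bigl => A; rewrite inE !eqxx !andbT.
transitivity (\sum_(B : indep_set e) \sum_(x : T | x \in (B : {set T})) 1).
  by apply: eq_bigr => B _; rewrite sum1_card.
rewrite (exchange_big_dep xpredT) //=; apply: eq_bigr => x _.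
rewrite sum1_card -cardsE -(card_imset _ val_inj).
apply: eq_card => A; rewrite inE; apply/imsetP/andP => [[B] | [eA Ax]].
  by rewrite inE => Bx ->; split; first exact: valP.
by exists (IndepSet eA); rewrite // inE.
Qed.

(** On a finite type [f] is bijective, hence a graph automorphism, and taking images under it
    matches the two families. *)
Lemma card_indep_containing_morph (f : T -> T) (x : T) :
  injective f -> {mono f : y z / e y z} ->
  #|[set A : {set T} | independent e A & f x \in A]|
  = #|[set A : {set T} | independent e A & x \in A]|.
Proof.
move=> f_inj f_mono; rewrite -[RHS](card_imset _ (imset_inj f_inj)).
apply: eq_card => A; rewrite inE; apply/andP/imsetP => [[eA Ax] | [B + ->]].
  exists (f @^-1: A).
    rewrite !inE Ax andbT; apply/independentP => y z; rewrite !inE => Ay Az.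
    by rewrite -f_mono; move/independentP: eA; apply.
  apply/setP => y; have [g fK gK] := injF_bij f_inj.
  by rewrite -[y]gK mem_imset // inE.
rewrite inE => /andP[/independentP eB Bx]; split; last by rewrite mem_imset.
apply/independentP => _ _ /imsetP[y By ->] /imsetP[z Bz ->].
by rewrite f_mono; exact: eB.
Qed.

(** Counting inside [D], rather than in an induced subgraph, keeps the recurrences on one vertex
    type. *)
Definition indep_count (D : {set T}) : nat :=
  #|[set A : {set T} | independent e A & A \subset D]|.

Lemma indep_count0 : indep_count set0 = 1.
Proof.
rewrite /indep_count (_ : [set _ | _ & _] = [set set0]) ?cards1 //.
apply/setP => A; rewrite !inE subset0 andbC; case: eqP => //= ->.
by apply/independentP => x y; rewrite inE.
Qed.

Hypotheses (e_sym : symmetric e) (e_irr : irreflexive e).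

(** Removing [x] is a bijection: putting it back is safe because its neighbours are excluded. *)
Lemma card_indep_containing (D : {set T}) (x : T) : x \in D ->
  #|[set A : {set T} | [&& independent e A, A \subset D & x \in A]]|
  = indep_count [set y in D | (y != x) && ~~ e x y].
Proof.
move=> Dx; set U := [set y in D | _].
have Ux : x \notin U by rewrite !inE eqxx andbF.
rewrite /indep_count -[RHS](@card_in_imset _ _ (fun A => x |: A)); last first.
  move=> A B; rewrite !inE => /andP[_ sA] /andP[_ sB] eqAB.
  have nA : x \notin A by apply: contra Ux; apply/subsetP.
  have nB : x \notin B by apply: contra Ux; apply/subsetP.
  by rewrite -(setU1K nA) eqAB setU1K.
apply: eq_card => A; rewrite inE; apply/and3P/imsetP => [[eA sAD Ax] | [B + ->]].
  exists (A :\ x); last by rewrite setD1K.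
  rewrite inE (independentS _ _ (subsetDl _ _) eA) /=.
  apply/subsetP => y; rewrite !inE => /andP[-> Ay].
  by rewrite (subsetP sAD) //=; move/independentP: eA; apply.
rewrite inE => /andP[/independentP eB /subsetP sBU].
have nxB y : y \in B -> ~~ e x y by move/sBU; rewrite !inE => /and3P[].
split; last exact: setU11.
  apply/independentP => y z; rewrite !inE => /predU1P[-> | By] /predU1P[-> | Bz].
  - by rewrite e_irr.
  - exact: nxB.
  - by rewrite e_sym nxB.
  - exact: eB.
by rewrite subUset sub1set Dx; apply/subsetP => y /sBU; rewrite inE => /andP[].
Qed.

Lemma indep_count_rec (D : {set T}) (x : T) : x \in D ->
  indep_count D
  = indep_count (D :\ x) + indep_count [set y in D | (y != x) && ~~ e x y].
Proof.
move=> Dx; rewrite -card_indep_containing // addnC.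
rewrite /indep_count -(cardsID [set A : {set T} | x \in A]); congr addn.
  by apply: eq_card => A; rewrite !inE andbA.
by apply: eq_card => A; rewrite !inE subsetD1 andbC andbA.
Qed.

End IndependentSets.

Section CyclePowers.

Variables (n h : nat).

Lemma cycle_power_sym : symmetric (@cycle_power n h).
Proof. by move=> i j; rewrite /cycle_power eq_sym distnC. Qed.

Lemma cycle_power_irr : irreflexive (@cycle_power n h).
Proof. by move=> i; rewrite /cycle_power eqxx. Qed.

(** If exactly one vertex wraps around, the distance [d] becomes [n - d], which swaps the two
    adjacency conditions. *)
Lemma cycle_power_ordS : h < n -> {mono @ordS n : i j / cycle_power h i j}.
Proof.
move=> hn i j; rewrite /cycle_power (inj_eq (@ordS_inj n)) -val_eqE /=.
have ordSE (k : 'I_n) : k.+1 %% n = if k.+1 == n then 0 else k.+1.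
  case: eqP => [-> | ?]; first exact: modnn.
  by rewrite modn_small //; have := ltn_ord k; lia.
rewrite !ordSE; have := ltn_ord i; have := ltn_ord j.
by case: (i.+1 =P n) => ?; case: (j.+1 =P n) => ?; lia.
Qed.

(** On the initial segment the truncated index is 0, and the dummy value [hfib h 0 = 0] keeps the
    recurrence valid. *)
Lemma hfibS k : hfib h k.+2 = hfib h k.+1 + hfib h (k.+1 - h).
Proof.
rewrite [LHS]/=; case: (leqP k.+1 h) => // kh.
by rewrite (eqP (_ : k.+1 - h == 0)) ?subn_eq0 //= (ltnW kh).
Qed.

(* On the vertices h, ..., n - h - 2 the wrap-around condition
   |j - i| >= n - h never holds. *)
Lemma indep_count_interval k : k + h.*2 < n ->
  indep_count _ (@cycle_power n h) [set x : 'I_n | h <= x < h + k] = hfib h (k + h).+1.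
Proof.
elim/ltn_ind: k => -[_ _ | k IHk kn].
  rewrite (_ : [set x | _] = set0) ?indep_count0 /= ?leqnn //.
  by apply/setP => x; rewrite !inE; lia.
have ltv : h + k < n by lia.
(* Split on the largest vertex of the interval. *)
pose v := Ordinal ltv.
rewrite (indep_count_rec _ _ cycle_power_sym cycle_power_irr _ v); last by rewrite inE /=; lia.
rewrite (_ : _ :\ v = [set x : 'I_n | h <= x < h + k]); last first.
  by apply/setP => x; rewrite !inE -val_eqE /=; lia.
rewrite (_ : [set y in _ | _] = [set x : 'I_n | h <= x < h + (k - h)]); last first.
  by apply/setP => x; rewrite !inE /cycle_power -!val_eqE /=; have := ltn_ord x; lia.
rewrite !IHk ?addSn; [|lia..].
rewrite hfibS; congr addn; case: (leqP h k) => hk; first by congr hfib; lia.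
(* For [k < h] the remaining interval is empty, and both indices [h.+1] and [k.+1] give the initial
   value 1. *)
rewrite (_ : k - h + h = h) ?hfib_init //; lia.
Qed.

Lemma card_indep_containing_vertex (v : 'I_n) : h < n ->
  #|[set A : {set 'I_n} | independent (@cycle_power n h) A & v \in A]| = hfib h (n - h).
Proof.
move=> hn; pose c (v : 'I_n) := #|[set A : {set 'I_n} | independent (@cycle_power n h) A & v \in A]|.
have ltl : n.-1 < n by lia.
pose l := Ordinal ltl.
have c_const : forall k (ltk : k < n), c (Ordinal ltk) = c l.
  have c_step (u : 'I_n) : c (ordS u) = c u.
    by apply: card_indep_containing_morph; [exact: ordS_inj | exact: cycle_power_ordS].
  (* Rotating the last vertex gives vertex 0, from which the others are reached. *)
  elim=> [|k IHk] ltk.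
    rewrite -(c_step l); congr c; apply: val_inj => /=.
    by rewrite prednK ?modnn; lia.
  rewrite -(IHk (ltnW ltk)) -[RHS]c_step; congr c; apply: val_inj => /=.
  by rewrite modn_small.
transitivity (c l); first by case: v => k ltk; exact: c_const.
rewrite /c (_ : [set A | _ & _] = [set A : {set 'I_n} |
    [&& independent (@cycle_power n h) A, A \subset setT & l \in A]]); last first.
  by apply/setP => A; rewrite !inE subsetT.
rewrite (card_indep_containing _ _ cycle_power_sym cycle_power_irr) ?inE //.
(* The closed neighbourhood of [l] consists of the first [h] and the last [h.+1] vertices; if these
   exhaust the cycle, then [n - h <= h] and both sides are 1. *)
rewrite (_ : [set y in _ | _] = [set x : 'I_n | h <= x < h + (n - h.*2.+1)]); last first.
  by apply/setP => x; rewrite !inE /cycle_power -!val_eqE /=; have := ltn_ord x; lia.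
case: (leqP h.*2.+1 n) => nh.
  by rewrite indep_count_interval; [congr hfib | ]; lia.
rewrite (_ : [set x | _] = set0) ?indep_count0 ?hfib_init //; first lia.
by apply/setP => x; rewrite !inE; lia.
Qed.

End CyclePowers.

Section Convolution.

Variable h : nat.

(** Reversed order: within each term [m] enters only the [hfib] index, so [hfibS] applies
    termwise. *)
Let conv m := \sum_(1 <= i < m.+1) hfib h (m.+1 - i) * hlucas h i.

Lemma conv_rec m : conv m.+1 = conv m + conv (m - h) + hlucas h m.+1.
Proof.
rewrite /conv big_nat_recr //= subSnn mul1n; congr addn.
(* The terms added by the longer range all contain [hfib h 0 = 0]. *)
have -> : \sum_(1 <= i < (m - h).+1) hfib h ((m - h).+1 - i) * hlucas h i
        = \sum_(1 <= i < m.+1) hfib h (m.+1 - i - h) * hlucas h i.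
  rewrite [RHS](@big_cat_nat _ _ _ (m - h).+1) //=; last lia.
  rewrite [X in _ = _ + X]big_nat_cond [X in _ = _ + X]big1 ?addn0; last first.
    by move=> i ?; rewrite (_ : m.+1 - i - h = 0) //; lia.
  by apply: eq_big_nat => i ?; congr (hfib h _ * _); lia.
rewrite -big_split /=; apply: eq_big_nat => i /andP[_]; rewrite ltnS => im.
by rewrite -mulnDl (subSn (leqW im)) (subSn im) hfibS.
Qed.

(** Both sides obey the same linear recurrence. This eliminates [hlucas] when [(m + h) * hfib h m]
    is checked against [conv_rec]. *)
Lemma hlucas_hfib m : hlucas h m.+1 + h * hfib h m = h.+1 * hfib h m.+1.
Proof.
elim/ltn_ind: m => -[_ | m IHm]; first by rewrite /= muln0 addn0 muln1.
case: (leqP m.+1 h) => hm.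
  by rewrite hlucas_init ?hfib_init ?(hfib_init h m.+1); lia.
(* Without the factor [h] this fails at [m = 0], but there [h <= m] forces [h = 0]. *)
have hfibSm : h * hfib h m.+1 = h * hfib h m + h * hfib h (m - h).
  case: (posnP h) => [-> // | h_gt0]; rewrite -mulnDr.
  by case: m {IHm} hm => [|m] hm; [lia | rewrite hfibS].
have -> : hlucas h m.+2 = hlucas h m.+1 + hlucas h (m - h).+1.
  by rewrite hlucas_rec; [congr (hlucas h _ + hlucas h _) | ]; lia.
rewrite hfibS mulnDr hfibSm addnACA (subSn (hm : h <= m)) !IHm ?ltnS ?leq_subr //; lia.
Qed.

Lemma sum_hfib_hlucas m :
  \sum_(1 <= i < m.+1) hfib h i * hlucas h (m - i + 1) = (m + h) * hfib h m.
Proof.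
transitivity (conv m).
  rewrite /conv big_nat_rev /=; apply: eq_big_nat => i ?.
  by congr (hfib h _ * hlucas h _); lia.
elim/ltn_ind: m => -[_ | m IHm]; first by rewrite /conv big_geq ?muln0.
rewrite conv_rec !IHm ?ltnS ?leq_subr //.
have := hlucas_hfib m; case: m {IHm} => [|m]; first by rewrite /=; lia.
rewrite hfibS; case: (leqP h m.+1) => hm; first by rewrite subnK //; lia.
(* The truncated index is 0, so the term [hfib h 0] vanishes whatever its coefficient. *)
rewrite (_ : m.+1 - h = 0) /=; lia.
Qed.

End Convolution.

Theorem theorem5p1 (n h : nat) (hn : h < n) :
  #|hasse_edges (indep_set (@cycle_power n h))|
  = \sum_(1 <= i < (n - h).+1) hfib h i * hlucas h (n - h - i + 1).
Proof.
rewrite card_hasse_edges_indep sum_hfib_hlucas subnK; last exact: ltnW.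
under eq_bigr do rewrite card_indep_containing_vertex //.
by rewrite sum_nat_const card_ord.
Qed.
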